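(* Let $P$ and $Q$ be probability densities on a common password space $\mathcal{PW}$ (continuous case), let $k\ge 2$ be an integer, and let $1\le i\le k$. Define $F(x)=\Pr_{pw\gets P}\!\left[\frac{P(pw)}{Q(pw)}\le x\right]$ and $G(x)=\Pr_{pw\gets Q}\!\left[\frac{P(pw)}{Q(pw)}\le x\right]$, and assume these cumulative distribution functions have densities $f$ and $g$ respectively. Let $M=\max_{x:\,Q(x)\neq 0}\frac{P(x)}{Q(x)}$ and suppose $f(+\infty):=\Pr_{pw\gets P}[Q(pw)=0]=0$. Then the flatness function satisfies $$\epsilon(i)=\sum_{j=1}^{i}\int_{0}^{M}\binom{k-1}{j-1} f(x)\,G^{k-j}(x)\,\bigl(1-G(x)\bigr)^{j-1}\,dx.$$
   Context: The flatness game $FlatGame^{P,Q,k}_{\mathcal{A}}(n)$: sample a password $pw\gets P$ and $k-1$ honeywords $hw_1,\dots,hw_{k-1}$ independently from $Q$; form the list $[pw,hw_1,\dots,hw_{k-1}]$ and shuffle it uniformly at random (this is the sweetword list). The attacker $\mathcal{A}$ (any probabilistic Turing machine, which may know $P$ and $Q$) receives the shuffled list and outputs $n$ guesses; it wins (the game outputs $1$) if $pw$ is among its guesses. Define $\epsilon_{\mathcal{A}}(i)=\Pr[FlatGame^{P,Q,k}_{\mathcal{A}}(i)=1]$ and the flatness function $\epsilon(i)=\max_{\mathcal{A}}\epsilon_{\mathcal{A}}(i)$ for $1\le i\le k$. *)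

(* Defs.v *)
From HB Require Import structures.
From mathcomp Require Import all_boot all_order all_algebra all_fingroup.
From mathcomp Require Import all_classical all_reals all_analysis.
Set Implicit Arguments. Unset Strict Implicit. Unset Printing Implicit Defensive.
Import Order.TTheory GRing.Theory Num.Theory.
Local Open Scope classical_set_scope.
Local Open Scope ring_scope.

Section FlatGame.
Context {R : realType} {d : measure_display} {T : measurableType d}.
Variable mu : {measure set T -> \bar R}.

Definition is_prob_density (D : T -> R) : Prop :=
  [/\ measurable_fun [set: T] D, (forall w, 0 <= D w) &
      (\int[mu]_w (D w)%:E = 1)%E].

Definition ratio (P Q : T -> R) (w : T) : \bar R :=
  if Q w == 0 then +oo%E else (P w / Q w)%:E.

(* Pr_{w <- D}[ P(w)/Q(w) <= x ] ; with D = P this is F, with D = Q this is G *)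
Definition ratio_cdf (P Q D : T -> R) (x : R) : R :=
  fine (\int[mu]_(w in [set w | (ratio P Q w <= x%:E)%E]) (D w)%:E).

Fixpoint iid_expect (Q : T -> R) (n : nat) : (n.-tuple T -> \bar R) -> \bar R :=
  match n with
  | 0 => fun G => G [tuple]
  | n'.+1 => fun G =>
      (\int[mu]_x ((Q x)%:E * iid_expect Q (fun t : n'.-tuple T => G (cons_tuple x t))))%E
  end.

(* The sweetword list: [pw, hw_1, ..., hw_{k-1}] shuffled by sigma
   (original position j is moved to position sigma j). *)
Definition sweetwords (k : nat) (pw : T) (h : k.-1.-tuple T) (s : 'S_k) : k.-tuple T :=
  [tuple (let j := (s^-1)%g m in if val j == 0%N then pw else nth pw h (val j).-1)
   | m < k].

(* An attacker outputting n guesses: a function of the sweetword list and of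
   its random seed r (uniform on [0,1]); it must be measurable. *)
Definition attacker (k n : nat) := k.-tuple T -> R -> n.-tuple T.

Definition admissible (k n : nat) (A : attacker k n) : Prop :=
  measurable_fun [set: (k.-tuple T * R)%type] (fun p => A p.1 p.2).

Definition flat_win (P Q : T -> R) (k n : nat) (A : attacker k n) : \bar R :=
  ((k`!%:R)^-1%:E *
   \sum_(s : 'S_k)
     \int[mu]_pw ((P pw)%:E *
        iid_expect Q (fun h : k.-1.-tuple T =>
          \int[lebesgue_measure]_(r in `[0%R, 1%R]) ((pw \in A (sweetwords pw h s) r)%:R)%:E)))%E.

Definition is_flatness (P Q : T -> R) (k n : nat) (v : \bar R) : Prop :=
  (exists A : attacker k n, admissible A /\ flat_win P Q A = v) /\
  (forall A : attacker k n, admissible A -> (flat_win P Q A <= v)%E).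

Definition is_max_ratio (P Q : T -> R) (M : R) : Prop :=
  (exists x, Q x != 0 /\ P x / Q x = M) /\ (forall x, Q x != 0 -> P x / Q x <= M).

End FlatGame.

Definition is_density_of {R : realType} (F f : R -> R) : Prop :=
  [/\ measurable_fun [set: R] f, (forall x, 0 <= f x) &
      forall x, (F x)%:E = (\int[lebesgue_measure]_(t in `]-oo, x]) (f t)%:E)%E].

(* Main.v *)
Require Import Defs.
From HB Require Import structures.
From mathcomp Require Import all_boot all_order all_algebra all_fingroup.
From mathcomp Require Import all_classical all_reals all_analysis.
From mathcomp Require Import measurable_realfun ring.
Import Order.TTheory GRing.Theory Num.Theory.
Local Open Scope classical_set_scope.
Local Open Scope ring_scope.
Set Implicit Arguments. Unset Strict Implicit. Unset Printing Implicit Defensive.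

(** Write [rho = P / Q]. Since [P] does not charge [{Q = 0}], sampling the
    password from [P] is sampling it from [Q] with weight [rho], so the [k]
    sweetwords become an i.i.d. sample [t] of [Q], and the winning probability
    of an attacker is the average over [m] of the expectation of
    [rho (t_m)] on the event that [t_m] is guessed. The law of [rho] under [Q]
    has a density, so almost surely the values [rho (t_m)] are pairwise
    distinct; then [i] guesses hit at most [i] positions, and the best choice is
    to guess the [i] sweetwords of largest ratio. For this attacker, the password
    [pw] is found iff fewer than [i] honeywords have a ratio above
    [rho (pw)], which is a binomial event of parameter [1 - G (rho (pw))];
    integrating against the law [f] of [rho (pw)] gives the formula. *)

(** * Densities and i.i.d. tuples *)

Section density_measure.
Local Open Scope ereal_scope.
Context (R : realType) (d : measure_display) (T : measurableType d).
Variables (mu : {measure set T -> \bar R}) (D : T -> R).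

Definition density_measure (mD : measurable_fun [set: T] D)
  (D0 : forall w, (0 <= D w)%R) : set T -> \bar R :=
  fun A => \int[mu]_(x in A) (D x)%:E.

Hypotheses (mD : measurable_fun [set: T] D) (D0 : forall w, (0 <= D w)%R).
Local Notation nu := (density_measure mD D0).

Let density0 : nu set0 = 0.
Proof. by rewrite /density_measure integral_set0. Qed.

Let density_ge0 A : 0 <= nu A.
Proof. by apply: integral_ge0 => /= x _; rewrite lee_fin. Qed.

Let density_sigma_additive : semi_sigma_additive nu.
Proof.
move=> /= F mF tF mUF; rewrite /density_measure; apply: cvg_toP.
  apply: ereal_nondecreasing_is_cvgn => m n mn.
  apply: lee_sum_nneg_natr => // k _ _.
  by apply: integral_ge0 => /= x Fkx; rewrite lee_fin.
rewrite ge0_integral_bigcup//=.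
- by apply: measurable_funTS; exact: measurableT_comp.
- by move=> x _; rewrite lee_fin.
Qed.

HB.instance Definition _ := isMeasure.Build _ _ _ nu
  density0 density_ge0 density_sigma_additive.

Import HBNNSimple.

Let integral_density_nnsfun (h : {nnsfun T >-> R}) :
  \int[nu]_x (h x)%:E = \int[mu]_x ((D x)%:E * (h x)%:E).
Proof.
under [LHS]eq_integral do rewrite fimfunE -fsumEFin//.
rewrite [LHS]ge0_integral_fsum//; last 2 first.
  - by move=> r; exact/measurable_EFinP/measurableT_comp.
  - by move=> n x _; rewrite EFinM nnfun_muleindic_ge0.
under [RHS]eq_integral.
  move=> x _; rewrite fimfunE -fsumEFin// ge0_mule_fsumr; last first.
    by move=> r; rewrite EFinM nnfun_muleindic_ge0.
  over.
rewrite [RHS]ge0_integral_fsum//; last 2 first.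
  - move=> r; apply/measurable_EFinP; apply/measurable_funM => //.
    exact: measurable_funM.
  - by move=> n x _; rewrite !EFinM mule_ge0 ?lee_fin// -lee_fin nnfun_muleindic_ge0.
apply: eq_fsbigr => r _.
rewrite integralZl_indic_nnsfun// integral_indic// setIT.
under [RHS]eq_integral do rewrite EFinM muleCA.
have [r0|r0] := leP 0%R r; last first.
  rewrite (_ : h @^-1` [set r] = set0); last first.
    by apply/seteqP; split => // x /= hx; move: r0; rewrite -hx ltNge fun_ge0.
  rewrite measure0 mule0 integral0_eq// => x _.
  by rewrite indicE in_set0 mule0 mule0.
rewrite ge0_integralZl//=; last 2 first.
- by apply/measurable_EFinP; apply: measurable_funM => //; exact: measurable_indic.
- by move=> x _; rewrite mule_ge0 ?lee_fin.
congr (_ * _); rewrite /density_measure integral_mkcond.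
by apply: eq_integral => x _; rewrite epatch_indic.
Qed.

(** Simple functions first, then monotone convergence along [nnsfun_approx] on both sides. *)
Lemma ge0_integral_density (f : T -> \bar R) :
    measurable_fun [set: T] f -> (forall x, 0 <= f x) ->
  \int[nu]_x f x = \int[mu]_x ((D x)%:E * f x).
Proof.
move=> mf f0; pose f_ := nnsfun_approx measurableT mf.
have f_cvg x : EFin \o f_ ^~ x @ \oo --> f x by exact: cvg_nnsfun_approx.
transitivity (limn (fun n => \int[nu]_x (f_ n x)%:E)).
  rewrite -monotone_convergence//=.
  - by apply: eq_integral => x _; apply/esym/cvg_lim => //; exact: f_cvg.
  - by move=> n; exact/measurable_EFinP.
  - by move=> n x _; rewrite lee_fin.
  - by move=> x _ a b ab; rewrite lee_fin//; exact/lefP/nd_nnsfun_approx.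
under eq_fun do rewrite integral_density_nnsfun.
rewrite -monotone_convergence//=.
- apply: eq_integral => x _; apply/cvg_lim => //.
  by apply: cvgeZl => //; exact: f_cvg.
- by move=> n; apply/measurable_EFinP; exact: measurable_funM.
- by move=> n x _; rewrite mule_ge0 ?lee_fin.
- move=> x _ a b ab; rewrite lee_wpmul2l ?lee_fin//.
  exact/lefP/nd_nnsfun_approx.
Qed.

End density_measure.

Section density_probability.
Local Open Scope ereal_scope.
Context (R : realType) (d : measure_display) (T : measurableType d).
Variables (mu : {measure set T -> \bar R}) (D : T -> R).

(** Takes the whole hypothesis [HD], so that total mass one is available. The match on [HD] blocks
    reduction, hence the unfolding equation that follows. *)
Definition density_prob (HD : is_prob_density mu D) : set T -> \bar R :=
  let: And3 mD D0 _ := HD in density_measure mu mD D0.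

Variable HD : is_prob_density mu D.

Lemma density_probE A : density_prob HD A = \int[mu]_(x in A) (D x)%:E.
Proof. by rewrite /density_prob; case: HD. Qed.

Let density_prob0 : density_prob HD set0 = 0.
Proof. by rewrite density_probE integral_set0. Qed.

Let density_prob_ge0 A : 0 <= density_prob HD A.
Proof. by rewrite /density_prob; case: HD. Qed.

Let density_prob_sigma_additive : semi_sigma_additive (density_prob HD).
Proof. rewrite /density_prob; case: HD => mD D0 _; exact: measure_semi_sigma_additive. Qed.

HB.instance Definition _ := isMeasure.Build _ _ _ (density_prob HD)
  density_prob0 density_prob_ge0 density_prob_sigma_additive.

Let density_prob_setT : density_prob HD setT = 1.
Proof. by rewrite density_probE; case: HD. Qed.

HB.instance Definition _ := Measure_isProbability.Build _ _ R
  (density_prob HD) density_prob_setT.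

Lemma ge0_integral_density_prob (f : T -> \bar R) :
    measurable_fun [set: T] f -> (forall x, 0 <= f x) ->
  \int[density_prob HD]_x f x = \int[mu]_x ((D x)%:E * f x).
Proof.
move=> mf f0; have [mD D0 _] := HD; rewrite -(ge0_integral_density _ mD D0)//.
by apply: eq_measure_integral => A _ _; rewrite [LHS]density_probE.
Qed.

End density_probability.

(** * Product laws on tuples and their exchangeability *)

Section tuple_probability.
Local Open Scope ereal_scope.
Context (R : realType) (d : measure_display) (T : measurableType d).
Variable nu : probability T R.

Definition cons_pair n (p : T * n.-tuple T) : n.+1.-tuple T := cons_tuple p.1 p.2.

Lemma measurable_cons_pair n : measurable_fun [set: T * n.-tuple T] (@cons_pair n).
Proof. exact: (measurable_cons measurable_fst measurable_snd). Qed.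

HB.instance Definition _ n := isMeasurableFun.Build _ _ _ _ (@cons_pair n)
  (@measurable_cons_pair n).

(** The [n]-fold product of [nu], built by the same recursion as [iid_expect], which makes the two
    comparable by induction. *)
Fixpoint tuple_prob n : probability (n.-tuple T) R :=
  match n with
  | 0 => dirac ([tuple] : 0.-tuple T)
  | m.+1 => distribution (nu \x tuple_prob m) (@cons_pair m)
  end.

Lemma ge0_integral_tuple_probS n (f : n.+1.-tuple T -> \bar R) :
    measurable_fun setT f -> (forall t, 0 <= f t) ->
  \int[tuple_prob n.+1]_t f t =
  \int[nu]_x \int[tuple_prob n]_t f (cons_tuple x t).
Proof.
move=> mf f0; rewrite /= ge0_integral_distribution// fubini_tonelli1//=.
by apply: measurableT_comp => //; exact: measurable_cons_pair.
Qed.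

Definition tuple_box n (B : 'I_n -> set T) : set (n.-tuple T) :=
  [set t | forall i, B i (tnth t i)].

Lemma measurable_tuple_box n (B : 'I_n -> set T) :
  (forall i, measurable (B i)) -> measurable (tuple_box B).
Proof.
move=> mB; rewrite (_ : tuple_box B =
  \bigcap_(i in [set: 'I_n]) (tnth (T:=T) ^~ i @^-1` B i)); last first.
  apply/seteqP; split => t /= tB i; first by move=> _; exact: tB.
  exact: (tB i I).
apply: fin_bigcap_measurable => // i _.
by rewrite -[X in measurable X]setTI; exact: measurable_tnth.
Qed.

Lemma tuple_prob_box n (B : 'I_n -> set T) : (forall i, measurable (B i)) ->
  tuple_prob n (tuple_box B) = \prod_(i < n) nu (B i).
Proof.
elim: n B => [|n IH] B mB /=.
  rewrite big_ord0 diracE (_ : _ \in _ = true)//.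
  by apply/mem_set => -[].
rewrite big_ord_recl /= -(IH (fun i => B (lift ord0 i)))//.
rewrite /distribution /pushforward -product_measure1E//; last first.
  exact: measurable_tuple_box.
congr (_ _); apply/seteqP; split => -[x t] /=.
  move=> tB; split; first by have := tB ord0; rewrite tnth0.
  by move=> i; have := tB (lift ord0 i); rewrite tnthS.
move=> [/= Bx tB] i; case: (unliftP ord0 i) => [j ->|->].
  by rewrite tnthS; exact: tB.
by rewrite tnth0.
Qed.

(** Uniqueness of measures asks for a generator stable under intersection: boxes are, one-coordinate
    cylinders are not. *)
Lemma measurable_tuple_boxE n : @measurable _ (n.-tuple T) =
  <<s [set tuple_box B | B in [set B : 'I_n -> set T | forall i, measurable (B i)]] >>.
Proof.
apply/seteqP; split.
  apply: smallest_sub; first exact: smallest_sigma_algebra.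
  rewrite -bigcup_seq => A [i _ [C mC <-]].
  apply: sub_sigma_algebra.
  exists (fun j => if j == i then C else setT) => /=.
    by move=> j; case: ifPn.
  rewrite setTI; apply/seteqP; split => t /=.
    by move=> /(_ i); rewrite eqxx.
  by move=> Ct j; case: ifPn => // /eqP ->.
apply: smallest_sub; first exact: sigma_algebra_measurable.
by move=> _ [B mB <-]; exact: measurable_tuple_box.
Qed.

Definition tuple_perm n (s : 'S_n) (t : n.-tuple T) : n.-tuple T :=
  [tuple tnth t ((s^-1)%g i) | i < n].

Lemma measurable_tuple_perm n (s : 'S_n) : measurable_fun setT (tuple_perm s).
Proof.
apply/measurable_fun_tnthP => i.
rewrite (_ : _ \o _ = (fun t : n.-tuple T => tnth t ((s^-1)%g i))).
  exact: measurable_tnth.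
by apply/funext => t /=; rewrite tnth_mktuple.
Qed.

HB.instance Definition _ n (s : 'S_n) := isMeasurableFun.Build _ _ _ _
  (@tuple_perm n s) (@measurable_tuple_perm n s).

(** Both laws give a box the same product up to the order of the factors, and boxes determine the
    law. *)
Lemma ge0_integral_tuple_perm n (s : 'S_n) (f : n.-tuple T -> \bar R) :
    measurable_fun setT f -> (forall t, 0 <= f t) ->
  \int[tuple_prob n]_t f (tuple_perm s t) = \int[tuple_prob n]_t f t.
Proof.
move=> mf f0.
rewrite -[LHS](@ge0_integral_distribution _ _ _ _ _ (tuple_prob n) (tuple_perm s))//.
apply: eq_measure_integral => A mA _.
apply: (measure_unique _ (fun=> setT) (measurable_tuple_boxE n)) => //.
- move=> _ _ [B1 mB1 <-] [B2 mB2 <-].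
  exists (fun i => B1 i `&` B2 i) => /=; first by move=> i; exact: measurableI.
  apply/seteqP; split => t /=; first by move=> B12; split => i; case: (B12 i).
  by move=> [tB1 tB2] i; split.
- by move=> _; exists (fun=> setT) => //; apply/seteqP; split.
- by rewrite bigcup_const.
- move=> _ [B mB <-]; rewrite [RHS]tuple_prob_box//.
  (* The preimage of the box [B] under [tuple_perm s] is the box with sides [B (s i)]. *)
  transitivity (tuple_prob n (tuple_box (fun i => B (s i)))); last first.
    by rewrite tuple_prob_box// [RHS](reindex_perm s).
  congr (tuple_prob n _).
  apply/seteqP; split => t /= tB i.
    by have := tB (s i); rewrite tnth_mktuple permK.
  by rewrite tnth_mktuple; have := tB ((s^-1)%g i); rewrite permKV.
- by move=> _; apply: (le_lt_trans (probability_le1 _ _)) => //; rewrite ltry.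
Qed.

End tuple_probability.

Section iid_expectation.
Local Open Scope ereal_scope.
Context (R : realType) (d : measure_display) (T : measurableType d).
Variables (mu : {measure set T -> \bar R}) (Q : T -> R).
Hypothesis HQ : is_prob_density mu Q.

Lemma measurable_cons_tuple n (x : T) :
  measurable_fun [set: n.-tuple T] (cons_tuple x).
Proof. exact: (measurable_cons (measurable_cst x) (@measurable_id _ _ setT)). Qed.

(** Tonelli at each level of the recursion merges the iterated integrals into one, where
    permutations and null sets can be handled. *)
Lemma iid_expectE n (f : n.-tuple T -> \bar R) :
    measurable_fun setT f -> (forall t, 0 <= f t) ->
  iid_expect mu Q f = \int[tuple_prob (density_prob HQ) n]_t f t.
Proof.
elim: n f => [|n IH] f mf f0 /=.
  rewrite integral_dirac//= diracE mem_set// mul1e; congr f; exact: val_inj.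
rewrite -[RHS]/(\int[tuple_prob _ n.+1]_t f t) ge0_integral_tuple_probS//.
rewrite ge0_integral_density_prob//; last 2 first.
- apply: (measurable_fun_fubini_tonelli_F (f \o @cons_pair _ _ _ )).
  + by apply: measurableT_comp => //; exact: measurable_cons_pair.
  + by move=> ?; exact: f0.
- by move=> x; exact: integral_ge0.
apply: eq_integral => x _; rewrite IH//.
by apply: measurableT_comp => //; exact: measurable_cons_tuple.
Qed.

End iid_expectation.

(** * The likelihood ratio *)

Section ray_generated.
Local Open Scope ereal_scope.
Context (R : realType).

Lemma measurable_rayE : @measurable _ (measurableTypeR R) =
  <<s [set A | exists x : R, A = `]-oo, x]%classic] >>.
Proof.
apply/seteqP; split.
  move=> A mA; have : <<s @RGenOInfty.G R >> A.
    exact: (eq_ind _ (fun S : set (set R) => S A) mA _ (RGenOInfty.measurableE R)).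
  apply: smallest_sub.
    exact: smallest_sigma_algebra.
  move=> _ [x ->]; rewrite -setCitvl.
  have [_ + _] := smallest_sigma_algebra setT
     [set A | exists x : R, A = `]-oo, x]%classic].
  rewrite -setTD; apply; apply: sub_sigma_algebra; by exists x.
apply: smallest_sub; first exact: sigma_algebra_measurable.
by move=> _ [x ->]; exact: measurable_itv.
Qed.

(** Closed left rays are stable under intersection and generate the Borel sets, and those ending at
    natural numbers exhaust the line. *)
Lemma measure_ray_unique (m1 m2 : {measure set (measurableTypeR R) -> \bar R}) :
    (forall x : R, m1 `]-oo, x]%classic = m2 `]-oo, x]%classic) ->
    (forall x : R, m1 `]-oo, x]%classic < +oo) ->
  forall A, measurable A -> m1 A = m2 A.
Proof.
move=> m12 m1oo A mA.
apply: (measure_unique _ (fun n : nat => `]-oo, (n%:R : R)]%classic : set (measurableTypeR R))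
  measurable_rayE) => //.
- move=> _ _ [x ->] [y ->]; exists (Num.min x y).
  by apply/seteqP; split => z /=; rewrite !in_itv/= le_min => /andP.
- by move=> n; exists n%:R.
- apply/seteqP; split => // x _.
  exists (Num.truncn `|x|).+1 => //=; rewrite in_itv/=.
  by rewrite (le_trans (ler_norm x))// ltW// truncnS_gt.
- by move=> _ [x ->].
Qed.

End ray_generated.

Section likelihood_ratio.
Local Open Scope ereal_scope.
Context (R : realType) (d : measure_display) (T : measurableType d).
Variables (mu : {measure set T -> \bar R}) (P Q : T -> R).
Hypotheses (HP : is_prob_density mu P) (HQ : is_prob_density mu Q).

(** Real-valued version of [ratio]: division by zero gives 0 where [ratio] is [+oo]. The two agree
    off [{Q = 0}]. *)
Definition lratio (P Q : T -> R) (w : T) : R := (P w / Q w)%R.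
Local Notation rho := (lratio P Q).

Lemma lratio_ge0 w : (0 <= rho w)%R.
Proof. by case: HP HQ => _ P0 _ [_ Q0 _]; rewrite divr_ge0. Qed.

Lemma measurable_lratio : measurable_fun setT rho.
Proof.
case: HP HQ => mP _ _ [mQ Q0 _]; apply: measurable_funM => //.
(* Inversion is measurable as the real power of exponent -1; the two coincide because [Q] is
   nonnegative. *)
rewrite (_ : (fun _ => _) = (fun w => powR (Q w) (-1))).
  exact: (measurableT_comp (measurable_powR (-1)) mQ).
by apply/funext => w; rewrite powR_inv1.
Qed.

Lemma measurable_density_zeros : measurable [set w | Q w = 0%R].
Proof.
case: HQ => mQ _ _; rewrite -[X in measurable X]setTI.
by apply: (mQ _ [set 0%R]) => //; exact: measurable_set1.
Qed.

(** The two events differ only inside [{Q = 0}], where [ratio] is [+oo] and [rho] is 0; that set is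
    null for [D]. *)
Lemma ratio_cdfE (D : T -> R) (HD : is_prob_density mu D) (x : R) :
    density_prob HD [set w | Q w = 0%R] = 0 ->
  (ratio_cdf mu P Q D x)%:E = density_prob HD [set w | (rho w <= x)%R].
Proof.
move=> D0.
have mR : measurable [set w | (rho w <= x)%R].
  rewrite -[X in measurable X]setTI.
  rewrite (_ : [set w | _] = rho @^-1` `]-oo, x]).
    by apply: measurable_lratio => //; exact: measurable_itv.
  by apply/seteqP; split => w /=; rewrite in_itv.
rewrite /ratio_cdf -(density_probE HD).
rewrite (_ : [set w | _] = [set w | (rho w <= x)%R] `\` [set w | Q w = 0%R]).
  rewrite [RHS](measureDI _ mR measurable_density_zeros)//= fineK; last first.
    rewrite ge0_fin_numE//; apply: (le_lt_trans (probability_le1 _ _)); last first.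
      by rewrite ltry.
    by apply: measurableD => //; exact: measurable_density_zeros.
  rewrite [X in _ = _ + X](_ : _ = 0) ?adde0//.
  apply: subset_measure0 D0 => //; last exact: measurable_density_zeros.
  by apply: measurableI => //; exact: measurable_density_zeros.
apply/seteqP; split => w /=; rewrite /Defs.ratio; have [Qw|/eqP Qw] := eqVneq (Q w) 0%R.
- by rewrite leye_eq.
- by rewrite lee_fin.
- by move=> [].
- by rewrite lee_fin => -[].
Qed.

Section distribution_of_ratio.
Variables (D : T -> R) (HD : is_prob_density mu D) (f : R -> R).
Hypotheses (D0 : density_prob HD [set w | Q w = 0%R] = 0)
  (Df : is_density_of (ratio_cdf mu P Q D) f).

(** Since [f] is a density of the distribution function, the two measures agree on the rays []-oo,
    x]], hence on all Borel sets. *)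
Lemma lratio_distribution A : measurable A ->
  density_prob HD (rho @^-1` A) = \int[lebesgue_measure]_(x in A) (f x)%:E.
Proof.
case: Df => mf f0 FE; move=> mA.
pose X : {mfun T >-> measurableTypeR R} := HB.pack rho
  (isMeasurableFun.Build _ _ T (measurableTypeR R) rho measurable_lratio).
transitivity (distribution (density_prob HD) X A) => //.
transitivity (density_measure lebesgue_measure mf f0 A) => //.
apply: (@measure_ray_unique R (distribution (density_prob HD) X)
  (density_measure (lebesgue_measure : {measure set (measurableTypeR R) -> \bar R}) mf f0)) => // x.
  rewrite -[RHS]/(\int[lebesgue_measure]_(t in `]-oo, x]) (f t)%:E) -FE ratio_cdfE//.
by apply: (le_lt_trans (probability_le1 _ _)); rewrite ?ltry.
Qed.

(** Applied to [Q], this is what excludes ties between sweetwords. *)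
Lemma lratio_atomless (x : R) : density_prob HD [set w | rho w = x] = 0.
Proof. by rewrite (lratio_distribution (measurable_set1 x)) integral_set1. Qed.

Lemma ge0_integral_lratio (phi : R -> \bar R) :
    measurable_fun setT phi -> (forall x, 0 <= phi x) ->
  \int[density_prob HD]_w phi (rho w) =
  \int[lebesgue_measure]_x ((f x)%:E * phi x).
Proof.
case: Df => mf f0 _ mphi phi0.
pose X : {mfun T >-> measurableTypeR R} := HB.pack rho
  (isMeasurableFun.Build _ _ T (measurableTypeR R) rho measurable_lratio).
transitivity (\int[distribution (density_prob HD) X]_x phi x).
  by rewrite ge0_integral_distribution.
transitivity (\int[density_measure lebesgue_measure mf f0]_x phi x); last first.
  exact: (@ge0_integral_density _ _ (measurableTypeR R)).
by apply: eq_measure_integral => A mA _; exact: lratio_distribution.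
Qed.

End distribution_of_ratio.

Lemma density_prob_zeros : density_prob HQ [set w | Q w = 0%R] = 0.
Proof. by rewrite density_probE integral0_eq// => w /= ->. Qed.

Hypothesis PQ0 : \int[mu]_(w in [set w | Q w = 0%R]) (P w)%:E = 0.

(** Off [{Q = 0}] the integrands agree because [P = Q * rho]; on [{Q = 0}] the right one is zero,
    and the left one is zero almost everywhere by [PQ0]. *)
Lemma ge0_integral_change_density (phi : T -> \bar R) :
    measurable_fun setT phi -> (forall x, 0 <= phi x) ->
  \int[mu]_w ((P w)%:E * phi w) = \int[mu]_w ((Q w)%:E * ((rho w)%:E * phi w)).
Proof.
move=> mphi phi0; case: (HP) (HQ) => mP P0 _ [mQ Q0 _].
have mrho := measurable_lratio.
apply: ge0_ae_eq_integral => //.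
- by apply: emeasurable_funM => //; exact/measurable_EFinP.
- do 2 (apply: emeasurable_funM => //; first exact/measurable_EFinP).
- by move=> w _; rewrite mule_ge0 ?lee_fin.
- by move=> w _; rewrite !mule_ge0 ?lee_fin// lratio_ge0.
have mP' : measurable_fun [set w | Q w = 0%R] (EFin \o P).
  by apply: measurable_funTS; exact/measurable_EFinP.
have [+ _] := ae_eq_integral_abs mu measurable_density_zeros mP'.
move=> /(_ _)[].
  by under eq_integral do rewrite /= ger0_norm//.
move=> N [mN N0 PN]; exists N; split => // w /= Hw; apply: PN => /= HP0.
apply: Hw => _; have [Qw|Qw] := eqVneq (Q w) 0%R.
  by have := HP0 Qw => /= ->; rewrite Qw !mul0e.
by rewrite muleA -EFinM /lratio mulrC divfK.
Qed.

(** At the price of the weight [rho] on the first coordinate, the password and the [n] honeywords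
    become one i.i.d. sample of [Q]. *)
Lemma ge0_integral_first_density n (Phi : n.+1.-tuple T -> \bar R) :
    measurable_fun setT Phi -> (forall t, 0 <= Phi t) ->
  \int[mu]_pw ((P pw)%:E * iid_expect mu Q (fun h => Phi (cons_tuple pw h))) =
  \int[tuple_prob (density_prob HQ) n.+1]_t ((rho (tnth t ord0))%:E * Phi t).
Proof.
move=> mPhi Phi0.
have mPc : measurable_fun setT (Phi \o @cons_pair _ T n).
  by apply: measurableT_comp => //; exact: measurable_cons_pair.
have mrho : measurable_fun setT (EFin \o rho).
  by apply/measurable_EFinP; exact: measurable_lratio.
have mPx x : measurable_fun setT (fun h : n.-tuple T => Phi (cons_tuple x h)).
  by apply: measurableT_comp => //; exact: measurable_cons_tuple.
have mI := @measurable_fun_fubini_tonelli_F _ _ _ _ R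
  (tuple_prob (density_prob HQ) n) _ mPc (fun=> Phi0 _).
under eq_integral do rewrite (iid_expectE HQ)//.
rewrite ge0_integral_change_density//; last by move=> x; exact: integral_ge0.
rewrite -(ge0_integral_density_prob HQ); last 2 first.
- by apply: emeasurable_funM.
- by move=> x; rewrite mule_ge0 ?lee_fin ?lratio_ge0//; exact: integral_ge0.
rewrite ge0_integral_tuple_probS; last 2 first.
- apply: emeasurable_funM => //.
  by apply: measurableT_comp mrho _; exact: measurable_tnth.
- by move=> t; rewrite mule_ge0 ?lee_fin ?lratio_ge0.
apply: eq_integral => x _; rewrite -ge0_integralZl// ?lee_fin ?lratio_ge0//.
Qed.

End likelihood_ratio.

(** * Ranks *)

Section permutation_average.
Local Open Scope ring_scope.

(** For a uniform [s], the image [s m] is uniform on the positions. Both sides are multiplied out so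
    that no division occurs. *)
Lemma sum_perm_image (V : zmodType) n (phi : 'I_n.+1 -> V) (m : 'I_n.+1) :
  (\sum_(s : 'S_n.+1) phi (s m)) *+ n.+1 = (\sum_j phi j) *+ n.+1`!.
Proof.
have same j : \sum_(s : 'S_n.+1) phi (s m) = \sum_(s : 'S_n.+1) phi (s j).
  (* Composing with the transposition of [m] and [j] trades [s m] for [s j]. *)
  rewrite (reindex_inj (mulgI (tperm m j))) /=.
  by apply: eq_bigr => s _; rewrite permM tpermL.
transitivity (\sum_(j < n.+1) \sum_(s : 'S_n.+1) phi (s j)).
  by under [RHS]eq_bigr => j _ do rewrite -same; rewrite sumr_const card_ord.
rewrite exchange_big /= -[in RHS](card_Sn n.+1) -sumr_const.
by apply: eq_bigr => s _; rewrite [RHS](reindex_perm s).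
Qed.

End permutation_average.

Section rank.
Local Open Scope set_scope.
Context (R : realType) (n : nat).
Implicit Types (x : 'I_n -> R) (c : {ffun 'I_n * 'I_n -> bool}).

(* Ranks, ties and the optimal guesses depend on [x] only through this finite
   table, so their measurability reduces to a finite case analysis. *)
Definition cmp_table x : {ffun 'I_n * 'I_n -> bool} := [ffun p => x p.1 < x p.2].

(** Ranks start at 0 with the largest value, since in a comparison table [c (m, j)] means that entry
    [j] exceeds entry [m]; equal values share a rank. *)
Definition rank c (m : 'I_n) : nat := #|[set j | c (m, j)]|.

Lemma rankE x m : rank (cmp_table x) m = #|[set j | x m < x j]|.
Proof. by congr #|pred_of_set _|; apply/setP => j; rewrite !inE ffunE. Qed.

Lemma rank_lt x m m' : x m < x m' -> (rank (cmp_table x) m' < rank (cmp_table x) m)%N.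
Proof.
move=> xm; rewrite !rankE; apply: proper_card; apply/properP; split.
  by apply/fintype.subsetP => j; rewrite !inE; exact: lt_trans.
by exists m'; rewrite !inE ?ltxx.
Qed.

Lemma rank_ord_subproof x m : (rank (cmp_table x) m < n)%N.
Proof.
rewrite rankE -[X in (_ < X)%N]card_ord -cardsT; apply: proper_card.
by apply/properP; split; [exact: finset.subsetT|exists m; rewrite !inE ?ltxx].
Qed.

Definition rank_ord x m : 'I_n := Ordinal (rank_ord_subproof x m).

Lemma rank_ord_inj x : injective x -> injective (rank_ord x).
Proof.
move=> xI m m' [] e; apply: xI; apply/eqP; rewrite eq_le !leNgt.
by apply/andP; split; apply/negP => /rank_lt; rewrite e ltnn.
Qed.

(** Without ties the ranks are a permutation of the [n] indices, so the count is that of the indices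
    below [i]. *)
Lemma card_top x i : injective x -> (i <= n)%N ->
  #|[set m | (rank (cmp_table x) m < i)%N]| = i.
Proof.
move=> xI lei.
have -> : [set m | (rank (cmp_table x) m < i)%N] =
    rank_ord x @^-1: [set j : 'I_n | (j < i)%N].
  by apply/setP => m; rewrite !inE.
rewrite on_card_preimset; last exact/onW_bij/injF_bij/rank_ord_inj.
by rewrite -sum1dep_card -(big_ord_widen _ (fun=> 1%N) lei) sum1_card card_ord.
Qed.

(** Exchange argument: a threshold [c] separates the top set [U] from its complement. Entries of [S]
    outside [U] are at most [c], entries of [U] outside [S] are at least [c], and the latter are at
    least as numerous. *)
Lemma sum_le_top x i (S : {set 'I_n}) : injective x -> (forall m, 0 <= x m) ->
    (i <= n)%N -> (#|S| <= i)%N ->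
  \sum_(m in S) x m <= \sum_(m | (rank (cmp_table x) m < i)%N) x m.
Proof.
move=> xI x0 lei leS; pose U := [set m | (rank (cmp_table x) m < i)%N].
rewrite [leRHS](_ : _ = \sum_(m in U) x m); last first.
  by apply: eq_bigl => m; rewrite inE.
have [c c0 [cU cS]] : exists2 c, 0 <= c &
    (forall m, m \in U -> c <= x m) /\ (forall m, m \notin U -> x m <= c).
  (* The largest value outside [U]; the default 0 covers an empty complement and keeps [c]
     nonnegative. *)
  exists (\big[Num.max/0]_(m | m \notin U) x m).
    by apply: bigmax_ge_id.
  split=> m mU; last by apply: le_bigmax_cond.
  apply: bigmax_le => // m' m'U; rewrite leNgt; apply/negP => /rank_lt.
  move: mU m'U; rewrite !inE -leqNgt => h1 h2 h3.
  by have := leq_trans (leq_ltn_trans h2 h3) (ltnW h1); rewrite ltnn.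
rewrite (big_setID U) [leRHS](big_setID S) /= [U :&: S]finset.setIC lerD2l.
apply: (@le_trans _ _ (\sum_(m in S :\: U) c)).
  by apply: ler_sum => m; rewrite inE => /andP[/cS].
apply: (@le_trans _ _ (\sum_(m in U :\: S) c)); last first.
  by apply: ler_sum => m; rewrite inE => /andP[_ /cU].
(* Adding the common part to both differences reduces the comparison of their sizes to
   [#|S| <= i = #|U|]. *)
rewrite !sumr_const ler_wpMn2l// -(leq_add2l #|S :&: U|) cardsID.
by rewrite [S :&: U]finset.setIC cardsID card_top.
Qed.

Lemma rank_perm x (s : 'S_n) m :
  rank (cmp_table (x \o (s^-1)%g)) (s m) = rank (cmp_table x) m.
Proof.
rewrite !rankE /= permK -[RHS](card_imset _ (@perm_inj _ s)).
congr #|pred_of_set _|; apply/setP => j; rewrite inE; apply/idP/imsetP.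
  by move=> xj; exists ((s^-1)%g j); rewrite ?inE ?permKV.
by move=> [j' + ->]; rewrite inE permK.
Qed.

End rank.

(** * Measurability by finite case analysis *)

Section finite_measurability.
Context (R : realType) (d d' d'' : measure_display) (X : measurableType d)
  (Y : measurableType d') (T : measurableType d'').

(** [F] carries no sigma-algebra: the measurability of [c] is stated on its fibres, and a preimage
    is a finite union over them. *)
Lemma measurable_fun_fintype (F : finType) (c : X -> F) (h : F -> X -> Y) :
    (forall y, measurable [set x | c x = y]) ->
    (forall y, measurable_fun setT (h y)) ->
  measurable_fun setT (fun x => h (c x) x).
Proof.
move=> mc mh _ B mB; rewrite setTI.
rewrite (_ : _ @^-1` B = \bigcup_(y in [set: F]) ([set x | c x = y] `&` (h y) @^-1` B)).
  apply: fin_bigcup_measurable => // y _; apply: measurableI => //.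
  by rewrite -[X in measurable X]setTI; exact: mh.
apply/seteqP; split => x /=; first by move=> Bx; exists (c x).
by move=> [y _ [/= -> ]].
Qed.

Lemma measurable_bool_natr (b : X -> bool) :
  measurable_fun setT b -> measurable_fun setT (fun x => (b x)%:R : R).
Proof.
move=> mb; rewrite (_ : (fun _ => _) = (fun x => if b x then 1 else 0)).
  exact: measurable_fun_ifT.
by apply/funext => x; case: (b x).
Qed.

Lemma measurable_cmp_table n (rho : T -> R) y : measurable_fun setT rho ->
  measurable [set t : n.-tuple T | cmp_table (fun j => rho (tnth t j)) = y].
Proof.
move=> mrho; rewrite (_ : [set _ | _] = \bigcap_(p in [set: 'I_n * 'I_n])
    [set t : n.-tuple T | (rho (tnth t p.1) < rho (tnth t p.2)) = y p]); last first.
  apply/seteqP; split => t /=; first by move=> <- p _ /=; rewrite ffunE.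
  by move=> H; apply/ffunP => p; rewrite ffunE; exact: (H p I).
apply: fin_bigcap_measurable => // p _.
have mt j : measurable_fun setT (fun t : n.-tuple T => rho (tnth t j)).
  by apply: measurableT_comp => //; exact: measurable_tnth.
rewrite -[X in measurable X]setTI.
exact: (measurable_fun_ltr (mt p.1) (mt p.2) measurableT (Y := [set y p])).
Qed.

End finite_measurability.

(** * Counts and ties in an i.i.d. sample *)

Section tuple_counts.
Local Open Scope ereal_scope.
Context (R : realType) (d : measure_display) (T : measurableType d).
Variables (nu : probability T R) (a : T -> bool).
Hypothesis ma : measurable_fun setT a.

Lemma measurable_count n :
  measurable_fun [set: n.-tuple T] (fun t : n.-tuple T => ((count a t)%:R : R)).
Proof.
rewrite (_ : (fun _ => _) =
    fun t : n.-tuple T => (\sum_(j < n) (a (tnth t j))%:R : R)%R); last first.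
  apply/funext => t; rewrite -sum1_count big_tuple big_mkcond natr_sum.
  by apply: eq_bigr => j _; case: (a _).
apply: measurable_sum => j; apply: measurable_bool_natr.
by apply: measurableT_comp => //; exact: measurable_tnth.
Qed.

Lemma measurable_count_eq n j :
  measurable_fun [set: n.-tuple T] (fun t : n.-tuple T => count a t == j).
Proof.
rewrite (_ : (fun _ => _) = (fun t : n.-tuple T => ((count a t)%:R == j%:R :> R))).
  by apply: measurable_fun_eqr => //; exact: measurable_count.
by apply/funext => t; rewrite eqr_nat.
Qed.

Lemma integral_bool_if (p q u v : R) :
    nu [set x | a x] = p%:E -> nu [set x | ~~ a x] = q%:E ->
    (0 <= u)%R -> (0 <= v)%R ->
  \int[nu]_x (if a x then u else v)%:E = (p * u + q * v)%:E.
Proof.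
move=> pE qE u0 v0.
have mp : measurable [set x | a x].
  by rewrite -[X in measurable X]setTI; exact: (ma measurableT (Y := [set true])).
have mq : measurable [set x | ~~ a x].
  rewrite (_ : [set _ | _] = ~` [set x | a x]); first exact: measurableC.
  by apply/seteqP; split => x /= /negP.
transitivity (\int[nu]_x (u%:E * (\1_[set x | a x] x)%:E +
                          v%:E * (\1_[set x | ~~ a x] x)%:E)).
  apply: eq_integral => x _; rewrite !indicE; case: ifPn => ax.
    rewrite mem_set// memNset ?mule1 ?mule0 ?adde0//=; exact/negP/negPn.
  rewrite memNset ?mem_set ?mule1 ?mule0 ?add0e//=; exact/negP.
rewrite ge0_integralD//; last 4 first.
- by move=> x _; rewrite mule_ge0 ?lee_fin.
- by apply/measurable_EFinP/measurable_funM => //; exact: measurable_indic.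
- by move=> x _; rewrite mule_ge0 ?lee_fin.
- by apply/measurable_EFinP/measurable_funM => //; exact: measurable_indic.
have mI A : measurable A -> measurable_fun setT (fun x : T => (\1_A x : R)%:E).
  by move=> mA; apply/measurable_EFinP; exact: measurable_indic.
rewrite !ge0_integralZl//; [|exact: mI|exact: mI].
rewrite !integral_indic// !setIT EFinD [in RHS]mulrC [(q * v)%R]mulrC !EFinM.
by congr (_ * _ + _ * _).
Qed.

(** The binomial law, by conditioning on the first entry: its two outcomes give the two terms of
    Pascal's rule. *)
Lemma integral_count_eq (p q : R) n j :
    nu [set x | a x] = p%:E -> nu [set x | ~~ a x] = q%:E ->
  \int[tuple_prob nu n]_t ((count a t == j)%:R)%:E =
  ('C(n, j)%:R * p ^+ j * q ^+ (n - j))%:E.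
Proof.
move=> pE qE.
have p0 : (0 <= p)%R by rewrite -lee_fin -pE.
have q0 : (0 <= q)%R by rewrite -lee_fin -qE.
elim: n j => [|n IH] j.
  rewrite /= integral_dirac//; last first.
    by apply/measurable_EFinP/measurable_bool_natr; exact: measurable_count_eq.
  rewrite diracT mul1e.
  by case: j => [|j]; rewrite ?bin0n ?expr0 ?mulr1 ?mul0r.
rewrite ge0_integral_tuple_probS; last 2 first.
- by apply/measurable_EFinP/measurable_bool_natr; exact: measurable_count_eq.
- by move=> t; rewrite lee_fin.
have b0 m l : (0 <= 'C(m, l)%:R * p ^+ l * q ^+ (m - l))%R.
  by rewrite !mulr_ge0 ?exprn_ge0.
case: j => [|j].
  transitivity (\int[nu]_x (if a x then 0 else 'C(n, 0)%:R * p ^+ 0 * q ^+ (n - 0))%:E).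
    apply: eq_integral => x _ /=; case: (a x); last by rewrite -IH.
    by rewrite integral0_eq// => t _; rewrite add1n.
  rewrite (integral_bool_if pE qE)//.
  by rewrite !bin0 !expr0 !subn0 mulr0 add0r !mul1r exprS.
transitivity (\int[nu]_x (if a x then 'C(n, j)%:R * p ^+ j * q ^+ (n - j)
   else 'C(n, j.+1)%:R * p ^+ j.+1 * q ^+ (n - j.+1))%:E).
  by apply: eq_integral => x _ /=; case: (a x); rewrite -IH.
rewrite (integral_bool_if pE qE)//; congr EFin.
rewrite binS natrD subSS.
(* When [n <= j] the subtraction [n - j.+1] is truncated, but then ['C(n, j.+1)] is 0; otherwise
   [n - j] is the successor of [n - j.+1]. *)
have [jn|jn] := leqP j.+1 n; last first.
  by rewrite (@bin_small n j.+1)// add0r !mul0r mulr0 addr0 exprS -!mulrA mulrCA.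
rewrite -[in RHS](subnSK jn) [in X in (X + _)%R](_ : (n - j = (n - j.+1).+1)%N); last by rewrite subnSK.
rewrite !exprS !mulrDl; ring.
Qed.

Lemma integral_count_lt (p q : R) n i :
    nu [set x | a x] = p%:E -> nu [set x | ~~ a x] = q%:E ->
  \int[tuple_prob nu n]_t ((count a t < i)%:R)%:E =
  (\sum_(j < i) 'C(n, j)%:R * p ^+ j * q ^+ (n - j))%:E.
Proof.
move=> pE qE.
transitivity (\int[tuple_prob nu n]_t \sum_(j < i) ((count a t == j)%:R)%:E).
  apply: eq_integral => t _; rewrite sumEFin; congr EFin.
  have [lti|lei] := ltnP.
    rewrite (bigD1 (Ordinal lti))//= eqxx big1 ?addr0// => j.
    by rewrite -val_eqE /= eq_sym => /negPf ->.
  by rewrite big1// => j _; rewrite gtn_eqF// (leq_trans (ltn_ord j)).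
rewrite ge0_integral_sum//; last first.
  move=> j; apply/measurable_EFinP/measurable_bool_natr; exact: measurable_count_eq.
by rewrite -sumEFin; apply: eq_bigr => j _; exact: integral_count_eq.
Qed.

(** The complement is a box whose sides all have probability one. *)
Lemma tuple_prob_has0 n : nu [set x | a x] = 0 ->
  tuple_prob nu n [set t : n.-tuple T | has a t] = 0.
Proof.
move=> a0.
have mp : measurable [set x | a x].
  by rewrite -[X in measurable X]setTI; exact: (ma measurableT (Y := [set true])).
have mB : measurable (tuple_box (fun _ : 'I_n => ~` [set x | a x])).
  by apply: measurable_tuple_box => _; exact: measurableC.
rewrite (_ : [set _ | _] = ~` tuple_box (fun _ : 'I_n => ~` [set x | a x])).
  rewrite probability_setC// tuple_prob_box; last by move=> _; exact: measurableC.
  rewrite big1 ?subee// => j _.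
  by rewrite probability_setC// a0 sube0.
apply/seteqP; split => t /=.
  move=> /hasP[x /tnthP[j ->] ax] /(_ j); exact.
move=> H; apply/negPn/negP => nh; apply: H => j /= aj.
by move/hasPn: nh => /(_ _ (mem_tnth j t)); rewrite aj.
Qed.

End tuple_counts.

(** * Almost sure absence of ties *)

Section ties.
Local Open Scope ereal_scope.
Context (R : realType) (d : measure_display) (T : measurableType d).
Variables (nu : probability T R) (rho : T -> R).
Hypotheses (mrho : measurable_fun setT rho)
  (atomless : forall x, nu [set w | rho w = x] = 0).

Definition no_ties n (t : n.-tuple T) : bool := uniq [seq rho w | w <- t].

Lemma no_tiesP n (t : n.-tuple T) : no_ties t -> injective (fun j => rho (tnth t j)).
Proof.
move=> /tuple_uniqP tU j j' e; apply: tU.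
by rewrite !tnth_map.
Qed.

Lemma no_ties_cmp n (t : n.-tuple T) : no_ties t =
  [forall j, forall j', (j != j') ==>
    (cmp_table (fun j => rho (tnth t j)) (j, j') ||
     cmp_table (fun j => rho (tnth t j)) (j', j))].
Proof.
apply/idP/'forall_forallP => [/no_tiesP tI j j'|H].
  by apply/implyP => jj'; rewrite !ffunE/= -neq_lt; apply: contra jj' => /eqP/tI ->.
apply/tuple_uniqP => j j'; rewrite !tnth_map => e; apply/eqP/negPn/negP => jj'.
by have := H j j'; rewrite jj' !ffunE/= e ltxx.
Qed.

Lemma measurable_no_ties n : measurable_fun [set: n.-tuple T] (@no_ties n).
Proof.
pose c (t : n.-tuple T) := cmp_table (fun j => rho (tnth t j)).
pose h (y : {ffun 'I_n * 'I_n -> bool}) (_ : n.-tuple T) :=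
  [forall j, forall j', (j != j') ==> (y (j, j') || y (j', j))].
rewrite (_ : @no_ties n = fun t => h (c t) t); last first.
  by apply/funext => t; exact: no_ties_cmp.
apply: (@measurable_fun_fintype _ _ _ _ _ c h) => y; last exact: measurable_cst.
exact: measurable_cmp_table.
Qed.

Lemma measurable_ties n : measurable [set t : n.-tuple T | ~~ no_ties t].
Proof.
rewrite -[X in measurable X]setTI.
rewrite (_ : [set _ | _] = @no_ties n @^-1` [set false]).
  exact: measurable_no_ties.
by apply/seteqP; split => t /=; [move/negPf|move=> ->].
Qed.

(** Induction on the size. For a fixed head [x], either the tail has a tie, which is null by
    induction, or some tail entry has ratio [rho x], which is null because the law of [rho] has no
    atoms. *)
Lemma tuple_prob_ties n : tuple_prob nu n [set t : n.-tuple T | ~~ no_ties t] = 0.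
Proof.
elim: n => [|n IH].
  rewrite (_ : [set _ | _] = set0) ?measure0//.
  by apply/seteqP; split => t //=; rewrite /no_ties tuple0.
transitivity (\int[tuple_prob nu n.+1]_t
    (\1_[set t : n.+1.-tuple T | ~~ no_ties t] t : R)%:E).
  by rewrite integral_indic ?setIT//; exact: measurable_ties.
rewrite ge0_integral_tuple_probS; last 2 first.
- by apply/measurable_EFinP; apply: measurable_indic; exact: measurable_ties.
- by move=> t; rewrite lee_fin.
apply: integral0_eq => x _.
have mx : measurable_fun setT (fun w => rho w == rho x).
  exact: measurable_fun_eqr.
have mh : measurable [set t : n.-tuple T | has (fun w => rho w == rho x) t].
  rewrite -[X in measurable X]setTI.
  have := measurable_count_eq R mx 0%N => /(_ n measurableT [set false]).
  rewrite (_ : _ @^-1` [set false] = [set t : n.-tuple T | has (fun w => rho w == rho x) t]).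
    by apply.
  apply/seteqP; split => t /=; rewrite has_count lt0n; first by move=> ->.
  by move/negPf.
apply/eqP; rewrite eq_le integral_ge0 ?andbT => [|t _]; last by rewrite lee_fin.
rewrite (_ : 0 = tuple_prob nu n ([set t : n.-tuple T | has (fun w => rho w == rho x) t]
   `|` [set t : n.-tuple T | ~~ no_ties t])); last first.
  apply/esym/null_set_setU => //; first exact: measurable_ties.
    apply: tuple_prob_has0 => //.
    rewrite -[RHS](atomless (rho x)); congr (nu _).
    by apply/seteqP; split => w /= /eqP.
set B := _ `|` _.
have mB : measurable B by apply: measurableU => //; exact: measurable_ties.
apply: (@le_trans _ _ (\int[tuple_prob nu n]_t (\1_B t : R)%:E)); last first.
  by rewrite integral_indic// setIT.
apply: ge0_le_integral => //.
- apply: (@measurableT_comp _ _ _ _ _ _ (EFin \o \1_[set t : n.+1.-tuple T | ~~ no_ties t])).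
    by apply/measurable_EFinP; apply: measurable_indic; exact: measurable_ties.
  exact: measurable_cons_tuple.
- by apply/measurable_EFinP; exact: measurable_indic.
move=> t _; rewrite lee_fin !indicE ler_nat.
case: (boolP (cons_tuple x t \in _)) => // /[!inE] /= nt; rewrite mem_set//.
move: nt; rewrite /no_ties /= negb_and negbK => /orP[|nt]; last by right.
by move=> /mapP[w wt e]; left => /=; apply/hasP; exists w => //; rewrite e.
Qed.

End ties.

(** * Optimal guessing *)

Lemma sume_const (R : realType) (I : finType) (x : \bar R) : (0 <= x)%E ->
  (\sum_(i : I) x = #|I|%:R%:E * x)%E.
Proof.
move=> x0; rewrite big_const; elim: #|_| => [|m IH] /=; first by rewrite mul0e.
by rewrite IH -nat1r EFinD ge0_muleDl ?lee_fin// mul1e.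
Qed.

Section guesses.
Context (d d' : measure_display) (X : measurableType d') (T : measurableType d).

(** Membership is a finite union of equalities between points, each of them a preimage of the
    diagonal. *)
Lemma measurable_mem_tuple n (u : X -> T) (v : X -> n.-tuple T) :
    measurable [set xy : T * T | xy.1 = xy.2] ->
    measurable_fun setT u -> measurable_fun setT v ->
  measurable_fun setT (fun x => u x \in v x).
Proof.
move=> mdiag mu mv; apply: (measurable_fun_bool true); rewrite setTI.
rewrite (_ : _ @^-1` _ = \bigcup_(j in [set: 'I_n])
    (fun x => (u x, tnth (v x) j)) @^-1` [set xy : T * T | xy.1 = xy.2]).
  apply: fin_bigcup_measurable => // j _; rewrite -[X in measurable X]setTI.
  apply: (measurable_fun_pair mu _) => //.
  exact: (measurableT_comp (measurable_tnth j) mv).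
apply/seteqP; split => x /=; first by move=> /tnthP[j e]; exists j.
by move=> [j _ /= ->]; exact: mem_tnth.
Qed.

Lemma card_guessed n i (t : n.-tuple T) (a : i.-tuple T) : injective (tnth t) ->
  (#|[set m | tnth t m \in a]%SET| <= i)%N.
Proof.
move=> tI; rewrite cardE -(size_map (tnth t)) -[X in (_ <= X)%N](size_tuple a).
apply: uniq_leq_size; first by rewrite map_inj_uniq// enum_uniq.
by move=> w /mapP[m]; rewrite mem_enum inE => ma ->.
Qed.

End guesses.

Section optimal_guessing.
Context (R : realType) (d : measure_display) (T : measurableType d).
Variables (rho : T -> R) (n i : nat).
Hypotheses (rho0 : forall w, 0 <= rho w) (lei : (i <= n.+1)%N).

Definition table (t : n.+1.-tuple T) := cmp_table (fun j => rho (tnth t j)).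

(** Over all shuffles [s m] runs evenly over the positions, so both sides become sums over
    positions. The guesses hit at most [i] of these, and [sum_le_top] applies. *)
Lemma guesses_le_top (t : n.+1.-tuple T) (a : i.-tuple T) (m : 'I_n.+1) :
    injective (fun j => rho (tnth t j)) ->
  \sum_(s : 'S_n.+1) rho (tnth t (s m)) * (tnth t (s m) \in a)%:R <=
  \sum_(s : 'S_n.+1) rho (tnth t (s m)) * (rank (table t) (s m) < i)%:R.
Proof.
move=> tI; rewrite -(@ler_pMn2r _ n.+1)//.
rewrite (sum_perm_image (fun j => rho (tnth t j) * (tnth t j \in a)%:R)).
rewrite (sum_perm_image (fun j => rho (tnth t j) * (rank (table t) j < i)%:R)).
rewrite ler_pMn2r ?fact_gt0//.
under eq_bigr do rewrite mulr_natr mulrb.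
under [leRHS]eq_bigr do rewrite mulr_natr mulrb.
rewrite -!big_mkcond /=.
rewrite [leLHS](_ : _ = \sum_(j in [set j | tnth t j \in a]%SET) rho (tnth t j)).
  apply: (@sum_le_top _ _ (fun j => rho (tnth t j))) => //.
  by apply: card_guessed => j j' e; apply: tI; rewrite e.
by apply: eq_bigl => j; rewrite inE.
Qed.

(** The default [ord0] serves tables where no entry has rank [j]; for the table of a tuple and
    [j <= n], this requires a tie. *)
Definition top_pick (c : {ffun 'I_n.+1 * 'I_n.+1 -> bool}) (j : nat) : 'I_n.+1 :=
  odflt ord0 [pick m | rank c m == j].

Definition top_attacker : @attacker R d T n.+1 i := fun t _ =>
  [tuple tnth t (top_pick (table t) j) | j < i].

Lemma measurable_table dY (Z : measurableType dY)
    (h : {ffun 'I_n.+1 * 'I_n.+1 -> bool} -> n.+1.-tuple T -> Z) :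
    measurable_fun setT rho -> (forall c, measurable_fun setT (h c)) ->
  measurable_fun setT (fun t : n.+1.-tuple T => h (table t) t).
Proof.
move=> mrho mh; apply: (@measurable_fun_fintype _ _ _ _ _ table h) => // y.
exact: measurable_cmp_table.
Qed.

Lemma admissible_top_attacker : measurable_fun setT rho -> admissible top_attacker.
Proof.
move=> mrho; apply/measurable_fun_tnthP => j.
rewrite (_ : _ \o _ = (fun t => tnth t (top_pick (table t) j)) \o fst); last first.
  by apply/funext => p /=; rewrite tnth_mktuple.
apply: measurableT_comp => //.
apply: (@measurable_table _ _ (fun c t => tnth t (top_pick c j))) => // c.
exact: measurable_tnth.
Qed.

Lemma mem_top_attacker (t : n.+1.-tuple T) r (m : 'I_n.+1) :
    injective (fun j => rho (tnth t j)) ->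
  (tnth t m \in top_attacker t r) = (rank (table t) m < i)%N.
Proof.
move=> tI; have rI := rank_ord_inj tI.
(* Without ties the ranks are injective on a finite set, hence onto, so a position of rank [j]
   exists. *)
have pickE (j : nat) : (j < n.+1)%N -> rank (table t) (top_pick (table t) j) = j.
  move=> jn; rewrite /top_pick; case: pickP => [m' /eqP //|/= noj].
  have /codomP[m' e] : Ordinal jn \in codom (rank_ord (fun j => rho (tnth t j))).
    exact: injF_onto.
  by have := noj m'; rewrite -[rank _ _]/(val (rank_ord _ m')) -e eqxx.
apply/idP/idP.
  move=> /tnthP[j]; rewrite tnth_mktuple => e.
  have -> : m = top_pick (table t) j by apply: tI; rewrite e.
  by rewrite pickE// (leq_trans (ltn_ord j)).
move=> mi; apply/tnthP; exists (Ordinal mi); rewrite tnth_mktuple.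
congr tnth; apply: rI; apply/val_inj => /=.
by rewrite -[RHS]/(rank (table t) _) pickE// (leq_trans mi).
Qed.

Lemma table_perm (s : 'S_n.+1) t :
  table (tuple_perm s t) = cmp_table ((fun j => rho (tnth t j)) \o (s^-1)%g).
Proof. by apply/ffunP => p; rewrite !ffunE /= !tnth_mktuple. Qed.

(** Turns the rank of the password into a count over the i.i.d. honeywords, whose law is binomial;
    the password is not above itself. *)
Lemma rank_cons_tuple (pw : T) (h : n.-tuple T) :
  rank (table (cons_tuple pw h)) ord0 = count (fun w => rho pw < rho w) h.
Proof.
rewrite rankE -sum1dep_card big_mkcond big_ord_recl /= !tnth0 ltxx add0n.
by rewrite -sum1_count big_tuple [RHS]big_mkcond; apply: eq_bigr => j _; rewrite tnthS.
Qed.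

End optimal_guessing.

(** * The flatness game *)

Section flatness.
Local Open Scope ereal_scope.
Context (R : realType) (d : measure_display) (T : measurableType d).
Variables (mu : {measure set T -> \bar R}) (P Q : T -> R).
Hypotheses (mdiag : measurable [set xy : T * T | xy.1 = xy.2])
  (HP : is_prob_density mu P) (HQ : is_prob_density mu Q)
  (PQ0 : \int[mu]_(w in [set w | Q w = 0%R]) (P w)%:E = 0).
Local Notation rho := (lratio P Q).
Local Notation nu := (density_prob HQ).
Local Notation seed := (uniform_prob (@ltr01 R)).

Let rho0 : forall w, (0 <= rho w)%R := lratio_ge0 HP HQ.
Let mrho : measurable_fun setT rho := measurable_lratio HP HQ.

Lemma measurable_rho_tnth n (m : 'I_n) :
  measurable_fun setT (fun t : n.-tuple T => rho (tnth t m)).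
Proof. by apply: measurableT_comp => //; exact: measurable_tnth. Qed.

Lemma integral_seed (phi : R -> \bar R) :
    measurable_fun setT phi -> (forall r, 0 <= phi r) ->
  \int[lebesgue_measure]_(r in `[0%R, 1%R]) phi r = \int[seed]_r phi r.
Proof.
by move=> mphi phi0; rewrite integral_uniform// subr0 invr1 mul1e.
Qed.

(** * Winning probability of a given attacker *)

Section attacker.
Variables (n i : nat) (A : @attacker R d T n.+1 i).
Hypothesis mA : admissible A.

Lemma measurable_win m : measurable_fun setT
  (fun p : n.+1.-tuple T * measurableTypeR R => tnth p.1 m \in A p.1 p.2).
Proof.
apply: measurable_mem_tuple => //.
by apply: (measurableT_comp (measurable_tnth m)).
Qed.

Lemma measurable_win_seed m t :
  measurable_fun setT (fun r : measurableTypeR R => ((tnth t m \in A t r)%:R : R)%:E).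
Proof.
apply/measurable_EFinP/measurable_bool_natr.
exact: (measurableT_comp (measurable_win m) (measurable_pair1 t)).
Qed.

(** Contribution of a password at position [m] when the whole list [t] is drawn from [Q]: the weight
    [rho] restores the law [P] there, and the seed is averaged out. *)
Definition payoff (m : 'I_n.+1) (t : n.+1.-tuple T) : \bar R :=
  \int[seed]_r (rho (tnth t m) * (tnth t m \in A t r)%:R)%:E.

Lemma measurable_payoff_joint m : measurable_fun setT
  (fun p : n.+1.-tuple T * measurableTypeR R =>
     (rho (tnth p.1 m) * (tnth p.1 m \in A p.1 p.2)%:R)%:E).
Proof.
apply/measurable_EFinP; apply: measurable_funM.
  exact: (measurableT_comp (measurable_rho_tnth m) measurable_fst).
by apply: measurable_bool_natr; exact: measurable_win.
Qed.

Lemma measurable_payoff m : measurable_fun setT (payoff m).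
Proof.
apply: (measurable_fun_fubini_tonelli_F _ (measurable_payoff_joint m)).
by move=> p; rewrite lee_fin mulr_ge0.
Qed.

Lemma payoff_ge0 m t : 0 <= payoff m t.
Proof. by apply: integral_ge0 => r _; rewrite lee_fin mulr_ge0. Qed.

Lemma payoffE m t : payoff m t =
  (rho (tnth t m))%:E *
  \int[lebesgue_measure]_(r in `[0%R, 1%R]) ((tnth t m \in A t r)%:R)%:E.
Proof.
rewrite integral_seed//; last exact: measurable_win_seed.
rewrite -ge0_integralZl ?lee_fin//; first exact: measurable_win_seed.
Qed.

Lemma sweetwords_perm (pw : T) (h : n.-tuple T) (s : 'S_n.+1) :
  @sweetwords d T n.+1 pw h s = tuple_perm s (cons_tuple pw h).
Proof.
apply: eq_from_tnth => m; rewrite !tnth_mktuple (tnth_nth pw) /=.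
by case: ((s^-1)%g m) => -[].
Qed.

(** For each shuffle [s] the password sits at position [s ord0] and receives the weight [rho];
    exchangeability then replaces the shuffled sample by the sample itself. *)
Lemma flat_win_payoff : flat_win mu P Q A =
  ((n.+1)`!%:R^-1)%:E *
  \sum_(s : 'S_n.+1) \int[tuple_prob nu n.+1]_t payoff (s ord0) t.
Proof.
rewrite /flat_win; congr (_ * _); apply: eq_bigr => s _.
pose Phi (t : n.+1.-tuple T) := \int[lebesgue_measure]_(r in `[0%R, 1%R])
  ((tnth t ord0 \in A (tuple_perm s t) r)%:R : R)%:E.
have mw : measurable_fun setT (fun p : n.+1.-tuple T * measurableTypeR R =>
    ((tnth p.1 ord0 \in A (tuple_perm s p.1) p.2)%:R : R)%:E).
  apply/measurable_EFinP/measurable_bool_natr/measurable_mem_tuple => //.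
    exact: (measurableT_comp (measurable_tnth ord0) measurable_fst).
  have mp : measurable_fun setT (fun p : n.+1.-tuple T * measurableTypeR R =>
      (tuple_perm s p.1, p.2)).
    apply: measurable_fun_pair => //.
    exact: (measurableT_comp (measurable_tuple_perm s) measurable_fst).
  exact: (measurableT_comp mA mp).
have PhiE t : Phi t = \int[seed]_r ((tnth t ord0 \in A (tuple_perm s t) r)%:R : R)%:E.
  rewrite /Phi integral_seed//.
  exact: (measurableT_comp mw (measurable_pair1 t)).
have mPhi : measurable_fun setT Phi.
  rewrite (_ : Phi = fun t => \int[seed]_r ((tnth t ord0 \in A (tuple_perm s t) r)%:R : R)%:E).
    exact: (measurable_fun_fubini_tonelli_F _ mw).
  by apply/funext => t; rewrite PhiE.
transitivity (\int[mu]_pw ((P pw)%:E * iid_expect mu Q (fun h => Phi (cons_tuple pw h)))).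
  apply: eq_integral => pw _; congr (_ * iid_expect _ _ _).
  by apply/funext => h; rewrite sweetwords_perm /Phi tnth0.
rewrite (ge0_integral_first_density HP HQ PQ0)//; last first.
  by move=> t; exact: integral_ge0.
(* The right-hand side is read at the shuffled sample, whose entry at [s ord0] is entry [ord0] of
   [t]. *)
rewrite -[RHS](ge0_integral_tuple_perm _ s); last 2 first.
- exact: measurable_payoff.
- exact: payoff_ge0.
apply: eq_integral => t _; rewrite payoffE tnth_mktuple permK.
by congr (_ * _).
Qed.

End attacker.

(** * Optimality of guessing the largest ratios *)

Section value.
Variables (n i : nat).
Hypothesis lei : (i <= n.+1)%N.

Definition top_payoff (m : 'I_n.+1) (t : n.+1.-tuple T) : R :=
  (rho (tnth t m) * (rank (table rho t) m < i)%:R)%R.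

Lemma top_payoff_ge0 m t : (0 <= top_payoff m t)%R.
Proof. by rewrite mulr_ge0. Qed.

Lemma measurable_rank_lt m : measurable_fun setT
  (fun t : n.+1.-tuple T => ((rank (table rho t) m < i)%:R : R)).
Proof.
by apply: (@measurable_table _ _ _ _ _ _ _ (fun c _ => (rank c m < i)%:R : R)).
Qed.

Lemma measurable_top_payoff m : measurable_fun setT (top_payoff m).
Proof.
apply: measurable_funM; first exact: measurable_rho_tnth.
exact: measurable_rank_lt.
Qed.

(** Position [ord0] alone suffices: by exchangeability all positions have the same mean. *)
Definition top_value : \bar R :=
  \int[tuple_prob nu n.+1]_t (top_payoff ord0 t)%:E.

Lemma integral_top_payoff (s : 'S_n.+1) :
  \int[tuple_prob nu n.+1]_t (top_payoff (s ord0) t)%:E = top_value.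
Proof.
rewrite -(ge0_integral_tuple_perm _ s); last 2 first.
- by apply/measurable_EFinP; exact: measurable_top_payoff.
- by move=> t; rewrite lee_fin top_payoff_ge0.
apply: eq_integral => t _.
by rewrite /top_payoff tnth_mktuple permK table_perm rank_perm.
Qed.

Lemma average_top_payoff : ((n.+1)`!%:R^-1)%:E *
  \sum_(s : 'S_n.+1) \int[tuple_prob nu n.+1]_t (top_payoff (s ord0) t)%:E =
  top_value.
Proof.
under eq_bigr do rewrite integral_top_payoff.
rewrite sume_const; last first.
  by apply: integral_ge0 => t _; rewrite lee_fin top_payoff_ge0.
by rewrite card_Sn muleA -EFinM mulVf ?mul1e.
Qed.

Hypothesis atomless : forall x, nu [set w | rho w = x] = 0.

Lemma ae_no_ties : {ae tuple_prob nu n.+1, forall t, no_ties rho t}.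
Proof.
exists [set t | ~~ no_ties rho t]; split.
- exact: measurable_ties.
- exact: tuple_prob_ties.
- by move=> t /= /negP.
Qed.

Lemma flat_win_le (A : @attacker R d T n.+1 i) : admissible A ->
  flat_win mu P Q A <= top_value.
Proof.
move=> mA; rewrite flat_win_payoff// -average_top_payoff.
rewrite lee_wpmul2l ?lee_fin ?invr_ge0//.
(* The bound is known for the sum over shuffles and not term by term, so the sum goes inside the
   integral first. *)
rewrite -!ge0_integral_sum//; first last.
- by move=> s t _; exact: payoff_ge0.
- by move=> s; exact: measurable_payoff.
- by move=> s t _; rewrite lee_fin top_payoff_ge0.
- by move=> s; apply/measurable_EFinP; exact: measurable_top_payoff.
apply: ae_ge0_le_integral => //.
- by move=> t _; apply: sume_ge0 => s _; exact: payoff_ge0.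
- by apply: emeasurable_sum => s; exact: measurable_payoff.
- by move=> t _; apply: sume_ge0 => s _; rewrite lee_fin top_payoff_ge0.
- by apply: emeasurable_sum => s; apply/measurable_EFinP; exact: measurable_top_payoff.
apply: filterS ae_no_ties => t /no_tiesP tI _.
rewrite -ge0_integral_sum//; last 2 first.
- move=> s; exact: (measurableT_comp (measurable_payoff_joint mA (s ord0)) (measurable_pair1 t)).
- by move=> s r _; rewrite lee_fin mulr_ge0.
(* The right side does not depend on the seed; as a constant integrated against mass one, it can be
   compared seed by seed. *)
rewrite sumEFin -[leRHS]mule1 -[X in _ <= _ * X](@probability_setT _ _ _ seed).
rewrite -integral_cst//; apply: ge0_le_integral => //.
- by move=> r _; apply: sume_ge0 => s _; rewrite lee_fin mulr_ge0.
- apply: emeasurable_sum => s.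
  exact: (measurableT_comp (measurable_payoff_joint mA (s ord0)) (measurable_pair1 t)).
move=> r _; rewrite sumEFin lee_fin; exact: guesses_le_top.
Qed.

(** Off the null set of ties, this attacker hits exactly the positions of rank below [i], so its
    payoff is [top_payoff] at each position. *)
Lemma flat_win_top : flat_win mu P Q (@top_attacker R d T rho n i) = top_value.
Proof.
have mA : admissible (@top_attacker R d T rho n i).
  exact: admissible_top_attacker.
rewrite flat_win_payoff// -average_top_payoff; congr (_ * _).
apply: eq_bigr => s _; apply: ge0_ae_eq_integral => //.
- exact: measurable_payoff.
- by apply/measurable_EFinP; exact: measurable_top_payoff.
- by move=> t _; exact: payoff_ge0.
- by move=> t _; rewrite lee_fin top_payoff_ge0.
apply: filterS ae_no_ties => t /no_tiesP tI _.
rewrite -[RHS]mule1 -[X in _ = _ * X](@probability_setT _ _ _ seed).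
rewrite -integral_cst//; apply: eq_integral => r _.
by rewrite mem_top_attacker.
Qed.

End value.

End flatness.

(** * The value of the game *)

Section value_formula.
Local Open Scope ereal_scope.
Context (R : realType) (d : measure_display) (T : measurableType d).
Variables (mu : {measure set T -> \bar R}) (P Q : T -> R) (f : R -> R) (M : R).
Hypotheses (HP : is_prob_density mu P) (HQ : is_prob_density mu Q)
  (PQ0 : \int[mu]_(w in [set w | Q w = 0%R]) (P w)%:E = 0)
  (Ff : is_density_of (ratio_cdf mu P Q P) f)
  (PQM : is_max_ratio P Q M).
Local Notation rho := (lratio P Q).
Local Notation nu := (density_prob HQ).
Local Notation G := (ratio_cdf mu P Q Q).

Let mrho : measurable_fun setT rho := measurable_lratio HP HQ.

Lemma ratio_cdf_prob x : nu [set w | (rho w <= x)%R] = (G x)%:E.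
Proof. by rewrite (ratio_cdfE HP HQ)//; exact: density_prob_zeros. Qed.

Lemma measurable_lratio_le x : measurable [set w | (rho w <= x)%R].
Proof.
rewrite -[X in measurable X]setTI.
rewrite (_ : [set w | _] = rho @^-1` `]-oo, x]).
  by apply: mrho => //; exact: measurable_itv.
by apply/seteqP; split => w /=; rewrite in_itv.
Qed.

Lemma ratio_cdf_prob_gt x : nu [set w | (x < rho w)%R] = (1 - G x)%:E.
Proof.
rewrite EFinB -ratio_cdf_prob -probability_setC; last exact: measurable_lratio_le.
by congr (nu _); apply/seteqP; split => w /=; rewrite ltNge => /negP.
Qed.

Lemma ratio_cdf_ge0 x : (0 <= G x)%R.
Proof. by rewrite -lee_fin -ratio_cdf_prob. Qed.

Lemma ratio_cdf_le1 x : (G x <= 1)%R.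
Proof. by rewrite -subr_ge0 -lee_fin -ratio_cdf_prob_gt. Qed.

Lemma measurable_ratio_cdf : measurable_fun setT G.
Proof.
apply: nondecreasing_measurable => // x y xy.
rewrite -lee_fin -!ratio_cdf_prob; apply: le_measure; rewrite ?inE.
- exact: measurable_lratio_le.
- exact: measurable_lratio_le.
by move=> w /= /le_trans; exact.
Qed.

Lemma lratio_bounds w : rho w \in `[0%R, M].
Proof.
rewrite in_itv/= (lratio_ge0 HP HQ)/=.
(* [M] is attained, hence a nonnegative ratio; this covers the points with [Q w = 0], where [rho] is
   0. *)
have [[x [_ <-]] maxM] := PQM; have [Qw|Qw] := eqVneq (Q w) 0%R; last exact: maxM.
by rewrite {1}/lratio Qw invr0 mulr0; exact: (lratio_ge0 HP HQ).
Qed.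

(** Probability that exactly [j] of [n] independent draws from [Q] have a ratio above [x]. *)
Definition binom_term n j (x : R) : R :=
  ('C(n, j)%:R * (1 - G x) ^+ j * G x ^+ (n - j))%R.

Lemma binom_term_ge0 n j x : (0 <= binom_term n j x)%R.
Proof.
by rewrite !mulr_ge0 ?exprn_ge0 ?subr_ge0 ?ratio_cdf_le1 ?ratio_cdf_ge0.
Qed.

Lemma measurable_binom_term n j : measurable_fun setT (binom_term n j).
Proof.
have mG := measurable_ratio_cdf.
by apply: measurable_funM; [apply: measurable_funM => //|]; apply: measurable_funX => //;
  exact: measurable_funB.
Qed.

(** The weight [rho] is absorbed back into [P]; for a fixed password the number of honeywords ranked
    above it is binomial of parameter [1 - G (rho pw)]. *)
Lemma top_value_density n i : top_value P HQ n i =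
  \int[density_prob HP]_w (\sum_(j < i) binom_term n j (rho w))%:E.
Proof.
pose Phi (t : n.+1.-tuple T) := ((rank (table rho t) ord0 < i)%:R : R)%:E.
have mPhi : measurable_fun setT Phi.
  by apply/measurable_EFinP; exact: (measurable_rank_lt HP HQ).
have mS : measurable_fun setT (fun x => \sum_(j < i) binom_term n j x)%R.
  by apply: measurable_sum => j; exact: measurable_binom_term.
rewrite ge0_integral_density_prob; last 2 first.
- by apply/measurable_EFinP; exact: (measurableT_comp mS mrho).
- by move=> w; rewrite lee_fin sumr_ge0// => j _; exact: binom_term_ge0.
transitivity (\int[tuple_prob nu n.+1]_t ((rho (tnth t ord0))%:E * Phi t)).
  by apply: eq_integral => t _.
rewrite -(ge0_integral_first_density HP HQ PQ0)//; last by move=> t; rewrite lee_fin.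
apply: eq_integral => pw _; congr (_ * _).
rewrite (iid_expectE HQ); last 2 first.
- exact: (measurableT_comp mPhi (measurable_cons_tuple pw)).
- by move=> t; rewrite lee_fin.
under eq_integral do rewrite /Phi rank_cons_tuple.
apply: integral_count_lt.
- exact: measurable_fun_ltr.
- exact: ratio_cdf_prob_gt.
- rewrite -ratio_cdf_prob; congr (nu _).
  by apply/seteqP; split => w /=; rewrite -leNgt.
Qed.

Lemma top_valueE n i : top_value P HQ n i =
  \sum_(1 <= j < i.+1)
    \int[lebesgue_measure]_(x in `[0%R, M])
      ('C(n, j.-1)%:R * f x * G x ^+ (n.+1 - j) * (1 - G x) ^+ j.-1)%:E.
Proof.
have [mf f0 _] := Ff.
have P0 : density_prob HP [set w | Q w = 0%R] = 0 by rewrite density_probE.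
have mS j : measurable_fun setT (EFin \o binom_term n j).
  by apply/measurable_EFinP; exact: measurable_binom_term.
rewrite top_value_density.
under eq_integral do rewrite -sumEFin.
rewrite ge0_integral_sum//; last 2 first.
- by move=> j; exact: (measurableT_comp (mS j) mrho).
- by move=> j w _; rewrite lee_fin binom_term_ge0.
(* The formula numbers its terms from 1, the binomial count from 0. *)
rewrite big_add1 /= big_mkord; apply: eq_bigr => j _.
(* Truncation to [[0, M]] is invisible on the values of [rho], and it confines the integral against
   [f] to that interval. *)
pose phi := (EFin \o binom_term n j) \_ `[0%R, M].
have phi0 x : 0 <= phi x by apply: erestrict_ge0 => y _; rewrite lee_fin binom_term_ge0.
have mphi : measurable_fun setT phi.
  by apply/(measurable_restrictT _ _).1 => //; exact: measurable_funTS.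
transitivity (\int[density_prob HP]_w phi (rho w)).
  apply: eq_integral => w _.
  by rewrite /phi patchE mem_set//; exact: lratio_bounds.
rewrite (ge0_integral_lratio HP HQ P0 Ff)// [RHS]integral_mkcond.
apply: eq_integral => x _; rewrite /phi !patchE; case: ifP => _; last by rewrite mule0.
rewrite -EFinM; congr EFin; rewrite /binom_term subSS.
by rewrite [(_ * f x)%R]mulrC -!mulrA; congr (_ * (_ * _))%R; rewrite mulrC.
Qed.

End value_formula.

Theorem theorem1 (R : realType) (d : measure_display) (T : measurableType d)
  (mu : {measure set T -> \bar R}) (P Q : T -> R) (k i : nat) (f g : R -> R) (M : R) :
  measurable [set xy : T * T | xy.1 = xy.2] ->
  is_prob_density mu P -> is_prob_density mu Q ->
  (2 <= k)%N -> (1 <= i <= k)%N ->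
  is_density_of (ratio_cdf mu P Q P) f ->
  is_density_of (ratio_cdf mu P Q Q) g ->
  is_max_ratio P Q M ->
  (\int[mu]_(w in [set w | Q w = 0%R]) (P w)%:E = 0)%E ->
  is_flatness mu P Q k i
    (\sum_(1 <= j < i.+1)
       \int[lebesgue_measure]_(x in `[0%R, M])
          (('C(k.-1, j.-1))%:R * f x * (ratio_cdf mu P Q Q x) ^+ (k - j)
             * (1 - ratio_cdf mu P Q Q x) ^+ j.-1)%:E)%E.
Proof.
move=> mdiag HP HQ k2 /andP[_ lei] Ff Gg PQM PQ0.
case: k k2 lei => [//|n] _ lei /=.
(* The density [g] of [G] is what rules out ties in a sample of [Q]. *)
have atomless x := lratio_atomless HP HQ (density_prob_zeros HQ) Gg x.
rewrite -(top_valueE HP HQ PQ0 Ff PQM); split.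
  exists (@top_attacker R d T (lratio P Q) n i); split.
    by apply: admissible_top_attacker; exact: (measurable_lratio HP HQ).
  exact: flat_win_top.
by move=> A mA; exact: flat_win_le.
Qed.
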